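(* Let $\rho:\Gamma_{\mathrm{cube}}\to G_{\mathsf{HP}^4}$ be a representation whose image is a cusp group or a collapsed cusp group. Then for all representations $\rho'$ in some neighbourhood of $\rho$ in $\mathrm{Hom}(\Gamma_{\mathrm{cube}},G_{\mathsf{HP}^4})$, exactly one of the following holds: (1) there are two distinct generators $s_1,s_2$ such that $\rho(s_1)=\rho(s_2)$ is a reflection in a non-degenerate hyperplane, and $\rho'(s_1)=\rho'(s_2)$; (2) the image of $\rho'$ is a cusp group.
   Context: Let $q_0(x)=-x_0^2+x_1^2+x_2^2+x_3^2$ on $\mathbb R^5$ (coordinates $x_0,\dots,x_4$, standard basis $e_0,\dots,e_4$). Half-pipe space is $\mathsf{HP}^4=\{x:q_0(x)=-1,\ x_0>0\}$, and $G_{\mathsf{HP}^4}$ is the group of linear maps $A$ preserving $q_0$ and $\mathsf{HP}^4$ with $Ae_4=\pm e_4$. Its boundary at infinity is $\partial\mathsf{HP}^4=\{x\neq0:q_0(x)=0\}/\mathbb R^*\subset\mathbb{RP}^4$. A hyperplane is the (non-empty) intersection of $\mathsf{HP}^4$ with a linear hyperplane of $\mathbb R^5$; it is degenerate if it contains a line $\{x+ce_4:c\in\mathbb R\}$ with $x\in\mathsf{HP}^4$, and non-degenerate (also called spacelike) otherwise. A hyperplane is asymptotic to a point $p\in\partial\mathsf{HP}^4$ if $p$ lies in its closure in $\mathbb{RP}^4$. A reflection is a non-trivial involution in $G_{\mathsf{HP}^4}$ fixing a hyperplane pointwise. $\Gamma_{\mathrm{cube}}$ is the right-angled Coxeter group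 generated by the reflections in the faces of a Euclidean cube: six generators of order two, one per face; generators of adjacent faces commute; no relation between opposite faces. The image of a representation $\Gamma_{\mathrm{cube}}\to G_{\mathsf{HP}^4}$ is called: - a cusp group if the six generators are sent to reflections in six distinct hyperplanes asymptotic to a common point at infinity; - a collapsed cusp group if the six generators are sent to reflections along five distinct hyperplanes, four degenerate and one non-degenerate, asymptotic to a common point at infinity. *)

(* Defs.v *)
From HB Require Import structures.
From mathcomp Require Import all_boot all_order all_algebra.
From mathcomp Require Import generic_quotient.
From mathcomp Require Import all_classical all_reals all_analysis.

Set Implicit Arguments.
Unset Strict Implicit.
Unset Printing Implicit Defensive.

Import Order.TTheory GRing.Theory Num.Theory.
Import numFieldNormedType.Exports.

Local Open Scope classical_set_scope.
Local Open Scope ring_scope.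
Local Open Scope quotient_scope.

Section HalfPipe.
Variable R : realType.
Implicit Types (x : 'cV[R]_5) (A : 'M[R]_5) (H : set 'cV[R]_5).

Definition xcoord x (k : nat) : R := x (inord k) ord0.

Definition q0 x : R :=
  - xcoord x 0 ^+ 2 + xcoord x 1 ^+ 2 + xcoord x 2 ^+ 2 + xcoord x 3 ^+ 2.

Definition e4 : 'cV[R]_5 := delta_mx (inord 4) ord0.

Definition HP4 : set 'cV[R]_5 := [set x | q0 x = -1 /\ 0 < xcoord x 0].

Definition is_HP4_isometry : set 'M[R]_5 := [set A |
  [/\ A \in unitmx,
      forall x, q0 (A *m x) = q0 x,
      [set A *m x | x in HP4] = HP4 &
      A *m e4 = e4 \/ A *m e4 = - e4]].

Definition GHP4 : Type := set_type is_HP4_isometry.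

HB.instance Definition _ := Topological.copy GHP4 (set_type is_HP4_isometry).

Definition mx_of (g : GHP4) : 'M[R]_5 := set_val g.

Lemma mx_of_inj : injective mx_of.
Proof. exact: val_inj. Qed.

Lemma mx_ofP (g : GHP4) : is_HP4_isometry (mx_of g).
Proof. exact: set_valP. Qed.

Lemma isometry1 : is_HP4_isometry 1%:M.
Proof.
split; [exact: unitmx1 | by move=> x; rewrite mul1mx | | by left; rewrite mul1mx].
by rewrite (_ : (fun x => _) = id) ?image_id//; apply/funext => x; rewrite mul1mx.
Qed.

Lemma isometryM A B :
  is_HP4_isometry A -> is_HP4_isometry B -> is_HP4_isometry (A *m B).
Proof.
move=> [uA qA hA eA] [uB qB hB eB]; split.
- by rewrite unitmx_mul uA.
- by move=> x; rewrite -mulmxA qA qB.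
- rewrite -[RHS]hA -[in RHS]hB image_comp.
  by apply: eq_imagel => x _ /=; rewrite mulmxA.
- rewrite -mulmxA.
  by case: eB => ->; case: eA => eA; rewrite ?mulmxN eA ?opprK; auto.
Qed.

Lemma isometryV A : is_HP4_isometry A -> is_HP4_isometry (invmx A).
Proof.
move=> [uA qA hA eA]; split.
- by rewrite unitmx_inv.
- by move=> x; rewrite -qA mulKVmx.
- rewrite -[in LHS]hA image_comp (_ : _ \o _ = id) ?image_id//.
  by apply/funext => x /=; rewrite mulKmx.
- case: eA => eA; [left|right].
  + by rewrite -{1}eA mulKmx.
  + by rewrite -[X in _ *m X]opprK -eA mulmxN mulKmx.
Qed.

Definition isom_of A (hA : is_HP4_isometry A) : GHP4 :=
  exist _ A (mem_set hA).

Lemma mx_of_isom A (hA : is_HP4_isometry A) : mx_of (isom_of hA) = A.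
Proof. by []. Qed.

Definition isom_one : GHP4 := isom_of isometry1.
Definition isom_mul (g h : GHP4) : GHP4 :=
  isom_of (isometryM (mx_ofP g) (mx_ofP h)).
Definition isom_inv (g : GHP4) : GHP4 := isom_of (isometryV (mx_ofP g)).

Lemma isom_mulA : associative isom_mul.
Proof. by move=> g h k; apply: mx_of_inj; rewrite !mx_of_isom mulmxA. Qed.
Lemma isom_mul1 : left_id isom_one isom_mul.
Proof. by move=> g; apply: mx_of_inj; rewrite !mx_of_isom mul1mx. Qed.
Lemma isom_1mul : right_id isom_one isom_mul.
Proof. by move=> g; apply: mx_of_inj; rewrite !mx_of_isom mulmx1. Qed.
Lemma isom_mulV : left_inverse isom_one isom_inv isom_mul.
Proof.
by move=> g; apply: mx_of_inj; rewrite !mx_of_isom mulVmx//; case: (mx_ofP g).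
Qed.
Lemma isom_Vmul : right_inverse isom_one isom_inv isom_mul.
Proof.
by move=> g; apply: mx_of_inj; rewrite !mx_of_isom mulmxV//; case: (mx_ofP g).
Qed.

HB.instance Definition _ := isGroup.Build GHP4
  isom_mulA isom_mul1 isom_1mul isom_mulV isom_Vmul.

Definition nonzero_vec : Type := set_type [set x : 'cV[R]_5 | x != 0].
HB.instance Definition _ :=
  Topological.copy nonzero_vec (set_type [set x : 'cV[R]_5 | x != 0]).

Definition vec_of (v : nonzero_vec) : 'cV[R]_5 := set_val v.

Definition proportional (v w : nonzero_vec) : bool :=
  `[< exists2 c : R, c != 0 & vec_of w = c *: vec_of v >].

Lemma proportional_refl : reflexive proportional.
Proof. by move=> v; apply/asboolP; exists 1; rewrite ?oner_eq0 ?scale1r. Qed.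

Lemma proportional_sym : symmetric proportional.
Proof.
suff h v w : proportional v w -> proportional w v.
  by move=> v w; apply/idP/idP; exact: h.
move=> /asboolP[c c0 wv]; apply/asboolP; exists c^-1; first by rewrite invr_eq0.
by rewrite wv scalerA mulVf// scale1r.
Qed.

Lemma proportional_trans : transitive proportional.
Proof.
move=> w v u /asboolP[c c0 wv] /asboolP[d d0 uw]; apply/asboolP.
by exists (d * c); rewrite ?mulf_neq0// uw wv scalerA.
Qed.

Canonical proportional_equiv :=
  EquivRel proportional proportional_refl proportional_sym proportional_trans.

Definition RP4 : Type := quotient_topology {eq_quot proportional}.
HB.instance Definition _ :=
  Topological.copy RP4 (quotient_topology {eq_quot proportional}).

Definition proj_class (v : nonzero_vec) : RP4 := \pi_{eq_quot proportional}%qT v.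

Definition boundary_HP4 : set RP4 :=
  [set proj_class v | v in [set v | q0 (vec_of v) = 0]].

Definition hyperplane H : Prop :=
  H !=set0 /\
  exists2 a : 'rV[R]_5, a != 0 & H = HP4 `&` [set x | a *m x = 0].

Definition degenerate H : Prop :=
  exists2 x, HP4 x & forall c : R, H (x + c *: e4).

Definition asymptotic H (p : RP4) : Prop :=
  boundary_HP4 p /\ closure [set proj_class v | v in [set v | H (vec_of v)]] p.

Definition reflection_in (g : GHP4) H : Prop :=
  [/\ hyperplane H, g <> 1%g, (g * g)%g = 1%g &
      forall x, H x -> mx_of g *m x = x].

End HalfPipe.

Arguments HP4 {R}.
Arguments GHP4 R : clear implicits.

(* The face (i, b) of the cube [-1, 1]^3 lies in the plane x_i = 1 or x_i = -1
   according to b; two distinct faces are opposite iff they have the same axis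
   i, and adjacent iff they have different axes. *)
Definition face : finType := ('I_3 * bool)%type.

Definition adjacent_faces (s t : face) : bool := s.1 != t.1.

(* Equality in the presented group of two words in the generators; the
   generators being involutions, words need no formal inverses. *)
Inductive same_elt : seq face -> seq face -> Prop :=
| same_refl w : same_elt w w
| same_sym u v : same_elt u v -> same_elt v u
| same_trans v u w : same_elt u v -> same_elt v w -> same_elt u w
| same_invol u s v : same_elt (u ++ [:: s; s] ++ v) (u ++ v)
| same_comm u s t v : adjacent_faces s t ->
    same_elt (u ++ [:: s; t] ++ v) (u ++ [:: t; s] ++ v).

Definition same_eltb (u v : seq face) : bool := `[< same_elt u v >].

Lemma same_eltb_refl : reflexive same_eltb.
Proof. by move=> w; apply/asboolP; exact: same_refl. Qed.
Lemma same_eltb_sym : symmetric same_eltb.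
Proof. by move=> u v; apply/asboolP/asboolP; exact: same_sym. Qed.
Lemma same_eltb_trans : transitive same_eltb.
Proof.
by move=> v u w /asboolP uv /asboolP vw; apply/asboolP; exact: same_trans vw.
Qed.

Canonical same_elt_equiv :=
  EquivRel same_eltb same_eltb_refl same_eltb_sym same_eltb_trans.

Lemma same_elt_catl w u v : same_elt u v -> same_elt (w ++ u) (w ++ v).
Proof.
elim=> {u v} [u|u v _|v u x _ h1 _ h2|u s v|u s t v st].
- exact: same_refl.
- exact: same_sym.
- exact: same_trans h2.
- by rewrite !(catA w); exact: same_invol.
- by rewrite !(catA w); exact: same_comm.
Qed.

Lemma same_elt_catr w u v : same_elt u v -> same_elt (u ++ w) (v ++ w).
Proof.
elim=> {u v} [u|u v _|v u x _ h1 _ h2|u s v|u s t v st].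
- exact: same_refl.
- exact: same_sym.
- exact: same_trans h2.
- by rewrite -!catA; exact: same_invol.
- by rewrite -!catA; exact: same_comm.
Qed.

Lemma same_elt_rev u v : same_elt u v -> same_elt (rev u) (rev v).
Proof.
elim=> {u v} [u|u v _|v u x _ h1 _ h2|u s v|u s t v st].
- exact: same_refl.
- exact: same_sym.
- exact: same_trans h2.
- by rewrite !rev_cat -catA; exact: same_invol.
- by rewrite !rev_cat -!catA; apply: same_comm; rewrite /adjacent_faces eq_sym.
Qed.

Lemma same_elt_revK u : same_elt (rev u ++ u) [::].
Proof.
elim: u => [|s u ih]; first exact: same_refl.
rewrite rev_cons -cats1 -catA.
exact: same_trans (same_invol (rev u) s u) ih.
Qed.

Definition gamma_cube : Type := {eq_quot same_eltb}.
HB.instance Definition _ := Choice.on gamma_cube.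

Definition word_class (w : seq face) : gamma_cube := \pi_{eq_quot same_eltb}%qT w.

Lemma word_classP u v : word_class u = word_class v <-> same_elt u v.
Proof. by split=> [/eqmodP/asboolP//|h]; apply/eqmodP/asboolP. Qed.

Lemma word_class_repr (g : gamma_cube) : word_class (repr g) = g.
Proof. exact: reprK. Qed.

Definition cube_one : gamma_cube := word_class [::].
Definition cube_mul (g h : gamma_cube) : gamma_cube :=
  word_class (repr g ++ repr h).
Definition cube_inv (g : gamma_cube) : gamma_cube := word_class (rev (repr g)).

Lemma cube_mulE u v :
  cube_mul (word_class u) (word_class v) = word_class (u ++ v).
Proof.
apply/word_classP; apply: (@same_trans (u ++ repr (word_class v))).
  by apply: same_elt_catr; apply/word_classP; rewrite word_class_repr.
by apply: same_elt_catl; apply/word_classP; rewrite word_class_repr.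
Qed.

Lemma cube_invE u : cube_inv (word_class u) = word_class (rev u).
Proof.
by apply/word_classP/same_elt_rev/word_classP; rewrite word_class_repr.
Qed.

Lemma cube_mulA : associative cube_mul.
Proof.
move=> g h k; rewrite -(word_class_repr g) -(word_class_repr h).
by rewrite -(word_class_repr k) !cube_mulE catA.
Qed.
Lemma cube_mul1 : left_id cube_one cube_mul.
Proof. by move=> g; rewrite -(word_class_repr g) cube_mulE. Qed.
Lemma cube_1mul : right_id cube_one cube_mul.
Proof. by move=> g; rewrite -(word_class_repr g) cube_mulE cats0. Qed.
Lemma cube_mulV : left_inverse cube_one cube_inv cube_mul.
Proof.
move=> g; rewrite -(word_class_repr g) cube_invE cube_mulE.
by apply/word_classP; exact: same_elt_revK.
Qed.
Lemma cube_Vmul : right_inverse cube_one cube_inv cube_mul.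
Proof.
move=> g; rewrite -(word_class_repr g) cube_invE cube_mulE.
by apply/word_classP; rewrite -[X in X ++ _]revK; exact: same_elt_revK.
Qed.

HB.instance Definition _ := isGroup.Build gamma_cube
  cube_mulA cube_mul1 cube_1mul cube_mulV cube_Vmul.

Definition cube_gen (s : face) : gamma_cube := word_class [:: s].

Definition cube_hom (R : realType) : Type := {multiplicative gamma_cube -> GHP4 R}.

Section Representations.
Variable R : realType.

Definition gen_image (rho : cube_hom R) (s : face) : GHP4 R := rho (cube_gen s).

HB.instance Definition _ := gen_eqMixin (cube_hom R).
HB.instance Definition _ := gen_choiceMixin (cube_hom R).
(* Hom(gamma_cube, G) is topologised as a subset of the product G^6 *)
HB.instance Definition _ := Topological.copy (cube_hom R)
  (initial_topology (gen_image : cube_hom R -> {ptws face -> GHP4 R})).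

Definition cusp_group (rho : cube_hom R) : Prop :=
  exists (H : face -> set 'cV[R]_5) (p : RP4 R),
    [/\ injective H,
        forall s, reflection_in (gen_image rho s) (H s) &
        forall s, asymptotic (H s) p].

Definition collapsed_cusp_group (rho : cube_hom R) : Prop :=
  exists (H : face -> set 'cV[R]_5) (p : RP4 R),
    [/\ (range H #= `I_5)%card,
        (range H `&` [set h | degenerate h] #= `I_4)%card,
        (range H `&` [set h | ~ degenerate h] #= `I_1)%card,
        forall s, reflection_in (gen_image rho s) (H s) &
        forall s, asymptotic (H s) p].

Definition nondegenerate_reflection (g : GHP4 R) : Prop :=
  exists2 H, ~ degenerate H & reflection_in g H.

End Representations.

(* Main.v *)
(* A reflection of [GHP4] is either [x - 2 b(v, x) v] (degenerate mirror, [b] the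
   polarisation of [q0], [b(v, v) = 1]) or [x - a(x) e4] with [a(e4) = 2]
   (non-degenerate mirror).  Two commuting reflections of the second kind are equal,
   distinct commuting ones of the first kind have [b(u, v) = 0], and mixed ones
   commute iff [a(v) = 0].  Signature (3,1) then forces the two non-degenerate
   mirrors of a (collapsed) cusp group onto one pair of opposite faces [a+], [a-],
   while the other four faces carry distinct degenerate mirrors [u, w] and [y, z]
   with [u, w] orthogonal to [y, z].  This pattern is open: involutions [A], [B]
   with [1 + A B] invertible are conjugate, and commuting degenerate reflections
   that stay distinct stay orthogonal.  After a deformation with this
   pattern, either [u, w, y, z, e4] span and [a+ = a-], since both forms kill
   [u, w, y, z] and agree at [e4]; or some nonzero [m] lies in both
   [<u, w>] and [<y, z>], so [m] is null, is killed by all six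
   forms, and is the common ideal point of the six mirrors. *)
Require Import Defs.
From mathcomp Require Import all_boot all_order all_algebra.
From mathcomp Require Import all_classical all_reals all_analysis.
From mathcomp Require Import ring lra.

Set Implicit Arguments.
Unset Strict Implicit.
Unset Printing Implicit Defensive.

Import Order.TTheory GRing.Theory Num.Theory.
Import numFieldNormedType.Exports.

Local Open Scope classical_set_scope.
Local Open Scope ring_scope.

(** * Linear algebra of the degenerate form on ['cV[R]_5] *)

Section LinearAlgebra.
Variable R : realType.

Lemma eq_mulmx_cV m n (A B : 'M[R]_(m, n)) :
  (forall x : 'cV[R]_n, A *m x = B *m x) -> A = B.
Proof.
move=> AB; apply/matrixP => i j.
by have /matrixP/(_ i 0) := AB (delta_mx j 0); rewrite -!colE !mxE.
Qed.

Lemma sum_ord5 (F : 'I_5 -> R) :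
  \sum_i F i = F (inord 0) + F (inord 1) + F (inord 2) + F (inord 3) + F (inord 4).
Proof.
rewrite !big_ord_recl big_ord0 addr0 !addrA.
by do !congr (_ + _); congr F; apply/val_inj; rewrite /= inordK.
Qed.

Lemma eq_cV5 (x y : 'cV[R]_5) :
  xcoord x 0 = xcoord y 0 -> xcoord x 1 = xcoord y 1 -> xcoord x 2 = xcoord y 2 ->
  xcoord x 3 = xcoord y 3 -> xcoord x 4 = xcoord y 4 -> x = y.
Proof.
move=> h0 h1 h2 h3 h4; apply/matrixP => i j; rewrite (ord1 j) -(inord_val i).
by case: i => [[|[|[|[|[|i]]]]] hi].
Qed.

(** Take the determinant of the matrix with columns [f i]: if it vanishes there is a kernel vector,
    otherwise the inverse supplies coordinates. *)
Lemma basis_or_dependent n (f : 'I_n -> 'cV[R]_n) :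
  (exists2 c : 'cV[R]_n, c != 0 & \sum_i c i 0 *: f i = 0) \/
  (forall x, exists c : 'cV[R]_n, x = \sum_i c i 0 *: f i).
Proof.
pose M := \matrix_(i, j) f j i 0.
have ME c : M *m c = \sum_i c i 0 *: f i.
  apply/matrixP => i j; rewrite !mxE summxE; apply: eq_bigr => k _.
  by rewrite !mxE (ord1 j) mulrC.
have [uM|] := boolP (M \in unitmx).
  by right=> x; exists (invmx M *m x); rewrite -ME mulKVmx.
rewrite unitmxE unitfE negbK -det_tr => /det0P[c c0 cM]; left.
by exists c^T; rewrite ?trmx_eq0 // -ME -[M]trmxK -trmx_mul cM trmx0.
Qed.

Lemma basis_or_dependent5 (u w y z t : 'cV[R]_5) :
  (exists a b c d e : R, ~ [/\ a = 0, b = 0, c = 0, d = 0 & e = 0] /\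
     a *: u + b *: w + c *: y + d *: z + e *: t = 0) \/
  (forall x, exists a b c d e : R,
     x = a *: u + b *: w + c *: y + d *: z + e *: t).
Proof.
have E (g : 'cV[R]_5) :
    \sum_i g i 0 *: [:: u; w; y; z; t]`_i =
      xcoord g 0 *: u + xcoord g 1 *: w + xcoord g 2 *: y
        + xcoord g 3 *: z + xcoord g 4 *: t.
  rewrite !big_ord_recl big_ord0 addr0 !addrA /=.
  by do !congr (_ + _); congr (g _ _ *: _); apply/val_inj; rewrite /= inordK.
have [[g g0]|sp] := basis_or_dependent (fun i : 'I_5 => [:: u; w; y; z; t]`_i).
  rewrite E => gE; left; exists (xcoord g 0), (xcoord g 1), (xcoord g 2).
  exists (xcoord g 3), (xcoord g 4); split=> // -[h0 h1 h2 h3 h4].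
  by case/eqP: g0; apply: eq_cV5; rewrite ?h0 ?h1 ?h2 ?h3 ?h4 /xcoord mxE.
right=> x; have [g ->] := sp x; rewrite E.
by exists (xcoord g 0), (xcoord g 1), (xcoord g 2), (xcoord g 3), (xcoord g 4).
Qed.

Lemma xcoordD (x y : 'cV[R]_5) k : xcoord (x + y) k = xcoord x k + xcoord y k.
Proof. by rewrite /xcoord mxE. Qed.
Lemma xcoordN (x : 'cV[R]_5) k : xcoord (- x) k = - xcoord x k.
Proof. by rewrite /xcoord mxE. Qed.
Lemma xcoordZ (c : R) (x : 'cV[R]_5) k : xcoord (c *: x) k = c * xcoord x k.
Proof. by rewrite /xcoord mxE. Qed.
Lemma xcoord0 k : xcoord (0 : 'cV[R]_5) k = 0.
Proof. by rewrite /xcoord mxE. Qed.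
Lemma xcoord_delta (i k : nat) : (i < 5)%N -> (k < 5)%N ->
  xcoord (delta_mx (inord i) 0 : 'cV[R]_5) k = (k == i)%:R.
Proof.
move=> i5 k5; rewrite /xcoord mxE eqxx andbT.
by rewrite -(inj_eq val_inj) /= !inordK.
Qed.
Lemma xcoord_e4 k : (k < 5)%N -> xcoord (e4 R) k = (k == 4)%:R.
Proof. exact: xcoord_delta. Qed.

Definition xcoordE := (xcoordD, xcoordN, xcoordZ, xcoord0).

Lemma e4_neq0 : e4 R != 0.
Proof.
apply/eqP => /(congr1 (fun v => xcoord v 4%N)); rewrite xcoord_e4 // xcoord0.
by move/eqP; rewrite oner_eq0.
Qed.

(** Polarisation of [q0]; its radical is the line of [e4]. *)
Definition bq (x y : 'cV[R]_5) : R :=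
  - (xcoord x 0 * xcoord y 0) + xcoord x 1 * xcoord y 1
  + xcoord x 2 * xcoord y 2 + xcoord x 3 * xcoord y 3.

Lemma q0E x : q0 x = bq x x. Proof. by []. Qed.
Lemma bqC x y : bq x y = bq y x. Proof. by rewrite /bq; ring. Qed.
Lemma bqDl x y z : bq (x + y) z = bq x z + bq y z.
Proof. by rewrite /bq !xcoordE; ring. Qed.
Lemma bqDr x y z : bq z (x + y) = bq z x + bq z y.
Proof. by rewrite /bq !xcoordE; ring. Qed.
Lemma bqZl c x y : bq (c *: x) y = c * bq x y.
Proof. by rewrite /bq !xcoordE; ring. Qed.
Lemma bqZr c x y : bq x (c *: y) = c * bq x y.
Proof. by rewrite /bq !xcoordE; ring. Qed.
Lemma bqNl x y : bq (- x) y = - bq x y.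
Proof. by rewrite /bq !xcoordE; ring. Qed.
Lemma bqNr x y : bq x (- y) = - bq x y.
Proof. by rewrite /bq !xcoordE; ring. Qed.
Lemma bq_e4l x : bq (e4 R) x = 0.
Proof. by rewrite /bq !xcoord_e4 //=; ring. Qed.
Lemma bq_e4r x : bq x (e4 R) = 0.
Proof. by rewrite bqC bq_e4l. Qed.
Lemma bq0l x : bq 0 x = 0.
Proof. by rewrite /bq !xcoord0; ring. Qed.
Lemma bq0r x : bq x 0 = 0.
Proof. by rewrite bqC bq0l. Qed.

Definition bqE :=
  (q0E, bqDl, bqDr, bqZl, bqZr, bqNl, bqNr, bq_e4l, bq_e4r, bq0l, bq0r).

Lemma spatial0_e4 (x : 'cV[R]_5) : xcoord x 0 = 0 -> xcoord x 1 = 0 ->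
  xcoord x 2 = 0 -> xcoord x 3 = 0 -> x = xcoord x 4 *: e4 R.
Proof.
by move=> h0 h1 h2 h3; apply: eq_cV5; rewrite xcoordZ xcoord_e4 //= ?mulr0 ?mulr1.
Qed.

Lemma bq_radical x : (forall y, bq x y = 0) -> exists c, x = c *: e4 R.
Proof.
move=> x0; exists (xcoord x 4); apply: spatial0_e4.
- by have := x0 (delta_mx (inord 0) 0); rewrite /bq !xcoord_delta //=; lra.
- by have := x0 (delta_mx (inord 1) 0); rewrite /bq !xcoord_delta //=; lra.
- by have := x0 (delta_mx (inord 2) 0); rewrite /bq !xcoord_delta //=; lra.
- by have := x0 (delta_mx (inord 3) 0); rewrite /bq !xcoord_delta //=; lra.
Qed.

Lemma null_time0 (m : 'cV[R]_5) : q0 m = 0 -> xcoord m 0 = 0 ->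
  exists c, m = c *: e4 R.
Proof.
rewrite /q0 => + m0; rewrite m0 expr0n oppr0 add0r => h.
by exists (xcoord m 4); apply: spatial0_e4 => //; apply/eqP; rewrite -sqrf_eq0;
  apply/eqP; move: (sqr_ge0 (xcoord m 1)) (sqr_ge0 (xcoord m 2));
  move: (sqr_ge0 (xcoord m 3)); lra.
Qed.

(** A timelike vector has nonzero time coordinate; dividing by the square root of [- q0 x], with the
    sign of that coordinate, lands on the upper sheet. *)
Lemma HP4_of_timelike (x : 'cV[R]_5) : q0 x < 0 -> exists2 c : R, c != 0 & HP4 (c *: x).
Proof.
move=> qx.
have x0 : xcoord x 0 != 0.
  apply/eqP => x0; move: qx; rewrite /q0 x0.
  by move: (sqr_ge0 (xcoord x 1)) (sqr_ge0 (xcoord x 2)) (sqr_ge0 (xcoord x 3)); lra.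
have s0 : 0 < Num.sqrt (- q0 x) by rewrite sqrtr_gt0; lra.
pose c := Num.sg (xcoord x 0) / Num.sqrt (- q0 x).
exists c; first by apply: mulf_neq0; [rewrite sgr_eq0 | rewrite invr_eq0 gt_eqF].
split.
  rewrite q0E bqZl bqZr -q0E mulrA -expr2 /c exprMn sqr_sg x0 mul1r exprVn.
  rewrite sqr_sqrtr; last lra.
  by rewrite invrN mulNr mulVf // lt_eqF.
by rewrite xcoordZ mulrAC -normrEsg mulr_gt0 ?invr_gt0 // normr_gt0.
Qed.

Lemma bq_timelike_null (x m : 'cV[R]_5) : q0 x < 0 -> q0 m = 0 -> bq x m = 0 ->
  exists c, m = c *: e4 R.
Proof.
move=> qx qm xm; apply: null_time0 => //; apply/eqP/negP => /negP m0.
(* This combination has time coordinate 0, so its [q0] is a sum of squares, while orthogonality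
   makes it a positive multiple of [q0 x < 0]. *)
have /eqP: q0 (xcoord m 0 *: x - xcoord x 0 *: m) = xcoord m 0 ^+ 2 * q0 x.
  by rewrite !bqE xm (bqC m x) xm -(q0E m) qm -(q0E x); ring.
apply/negP; rewrite gt_eqF //; apply: (@lt_le_trans _ _ 0).
  by rewrite pmulr_rlt0 // exprn_even_gt0.
rewrite /q0 !xcoordE mulrC subrr expr0n oppr0 add0r.
by rewrite !addr_ge0 // sqr_ge0.
Qed.

(* The orthogonal complement of three orthonormal vectors is negative definite
   modulo [e4]. *)
Lemma orthonormal3_null (u y x m : 'cV[R]_5) :
  q0 u = 1 -> q0 y = 1 -> q0 x = 1 -> bq u y = 0 -> bq u x = 0 -> bq y x = 0 ->
  q0 m = 0 -> bq m u = 0 -> bq m y = 0 -> bq m x = 0 -> exists c, m = c *: e4 R.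
Proof.
move=> qu qy qx uy ux yx qm mu my mx.
have [[a [b [c [d [e [ne dep]]]]]]|sp] := basis_or_dependent5 u y x m (e4 R).
  have ev v : bq (a *: u + b *: y + c *: x + d *: m + e *: e4 R) v = 0.
    by rewrite dep bq0l.
  have a0 : a = 0.
    by have := ev u; rewrite !bqE (bqC y) (bqC x) uy ux mu -q0E qu; lra.
  have b0 : b = 0.
    by have := ev y; rewrite !bqE (bqC x) uy yx my -q0E qy; lra.
  have c0 : c = 0.
    by have := ev x; rewrite !bqE ux yx mx -q0E qx; lra.
  move: dep; rewrite a0 b0 c0 !scale0r !add0r => /eqP.
  rewrite addr_eq0 => /eqP dep.
  have d0 : d != 0.
    apply/eqP => d0; apply: ne; split => //; move/esym/eqP: dep.
    by rewrite d0 scale0r oppr_eq0 scaler_eq0 (negPf e4_neq0) orbF => /eqP.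
  exists (- (e / d)); apply: (scalerI d0).
  by rewrite dep scalerA mulrN mulrCA divff // mulr1 scaleNr.
(* If the five vectors spanned, the timelike [t] would have a sum of three squares as its [q0]. *)
pose t : 'cV[R]_5 := delta_mx (inord 0) 0.
have qt : q0 t = -1 by rewrite /q0 !xcoord_delta //=; ring.
have [a [b [c [d [e tE]]]]] := sp t; exfalso.
have : q0 t = a ^+ 2 + b ^+ 2 + c ^+ 2.
  rewrite tE !bqE (bqC y u) (bqC x u) (bqC x y) (bqC u m) (bqC y m) (bqC x m).
  by rewrite uy ux yx mu my mx -!q0E qu qy qx qm; ring.
by rewrite qt; move: (sqr_ge0 a) (sqr_ge0 b) (sqr_ge0 c); lra.
Qed.

(** Linear independence in the quotient by [e4], a Minkowski space on which the form is
    non-degenerate. *)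
Definition indep_e4 (u w : 'cV[R]_5) :=
  forall a b c, a *: u + b *: w = c *: e4 R -> a = 0 /\ b = 0.

(* Two orthogonal planes that fail to span meet, and a common vector is null. *)
Lemma span_or_null (u w y z : 'cV[R]_5) :
  indep_e4 u w -> indep_e4 y z ->
  bq u y = 0 -> bq u z = 0 -> bq w y = 0 -> bq w z = 0 ->
  (forall x, exists a b c d e : R,
     x = a *: u + b *: w + c *: y + d *: z + e *: e4 R) \/
  (exists a b, let m := a *: u + b *: w in
     [/\ ~ (exists c, m = c *: e4 R), q0 m = 0,
         bq m u = 0 /\ bq m w = 0 & bq m y = 0 /\ bq m z = 0]).
Proof.
move=> iuw iyz uy uz wy wz.
have [[a [b [c [d [e [ne dep]]]]]]|sp] := basis_or_dependent5 u w y z (e4 R);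
  last by left.
right; exists a, b => m.
(* The dependence rewrites [m] through [y], [z], [e4], so [m] is orthogonal to [u] and [w], hence to
   itself. *)
have mE : m = - (c *: y + d *: z + e *: e4 R).
  by apply/eqP; rewrite -addr_eq0 !addrA dep.
have mu : bq m u = 0 by rewrite mE !bqE (bqC y) (bqC z) uy uz; ring.
have mw : bq m w = 0 by rewrite mE !bqE (bqC y) (bqC z) wy wz; ring.
split => //; last by rewrite /m !bqE uy uz wy wz; split; ring.
- move=> [k mk]; have [a0 b0] := iuw _ _ _ mk.
  have m0 : m = 0 by rewrite /m a0 b0 !scale0r addr0.
  have : c *: y + d *: z = (- e) *: e4 R.
    by apply/eqP; rewrite scaleNr -addr_eq0 -oppr_eq0 -mE m0.
  move=> /iyz[c0 d0]; apply: ne; split => //; move/eqP: mE.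
  rewrite m0 c0 d0 !scale0r !add0r eq_sym oppr_eq0 scaler_eq0.
  by rewrite (negPf e4_neq0) orbF => /eqP.
- by rewrite q0E {2}/m bqDr !bqZr mu mw; ring.
Qed.

End LinearAlgebra.

(** * Normal forms of reflections, their mirrors and commutation *)

Section Reflections.
Variable R : realType.
Implicit Types (g h : GHP4 R) (a : 'rV[R]_5) (u v w x y m : 'cV[R]_5).

Lemma subr_eq_self x y : (x - y == x) = (y == 0).
Proof. by rewrite -subr_eq0 addrAC subrr sub0r oppr_eq0. Qed.

Definition ev a x : R := (a *m x) 0 0.

Lemma evD a x y : ev a (x + y) = ev a x + ev a y.
Proof. by rewrite /ev mulmxDr mxE. Qed.
Lemma evN a x : ev a (- x) = - ev a x.
Proof. by rewrite /ev mulmxN mxE. Qed.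
Lemma evZ a c x : ev a (c *: x) = c * ev a x.
Proof. by rewrite /ev -scalemxAr mxE. Qed.
Lemma ev_scalel a c x : ev (c *: a) x = c * ev a x.
Proof. by rewrite /ev -scalemxAl mxE. Qed.
Lemma ev_eq0 a x : a *m x = 0 <-> ev a x = 0.
Proof.
split=> [|h]; first by rewrite /ev => ->; rewrite mxE.
by apply/matrixP => i j; rewrite !ord1 [LHS]h mxE.
Qed.
Definition evE := (evD, evN, evZ).

Lemma ev_neq0 a : a != 0 -> exists y, ev a y = 1.
Proof.
move=> a0; have /existsP[j aj] : [exists j, a 0 j != 0].
  apply/existsP; apply: contraNP a0 => /forallNP a0.
  by apply/eqP/rowP => j; rewrite mxE; apply/eqP/negPn/negP/a0.
exists ((a 0 j)^-1 *: delta_mx j 0); rewrite evZ /ev -colE mxE mulVf //.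
Qed.

(** The Gram matrix diag(-1, 1, 1, 1, 0) applied to [v]: the row vector of the functional [bq v]. *)
Definition dual v : 'rV[R]_5 :=
  \row_j ((if j == inord 0 then -1 else if j == inord 4 then 0 else 1) * v j 0).

Lemma ev_dual v x : ev (dual v) x = bq v x.
Proof.
rewrite /ev mxE sum_ord5 !mxE -!(inj_eq val_inj) /= !inordK //= /bq /xcoord; ring.
Qed.

Lemma mx_ofM g h : mx_of (g * h)%g = mx_of g *m mx_of h. Proof. by []. Qed.
Lemma mx_of1 : mx_of (1%g : GHP4 R) = 1%:M. Proof. by []. Qed.

Lemma eq_isom g h : (forall x, mx_of g *m x = mx_of h *m x) -> g = h.
Proof. by move=> gh; apply/mx_of_inj/eq_mulmx_cV. Qed.

Lemma isom_HP4 g x : HP4 x -> HP4 (mx_of g *m x).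
Proof. by move=> hx; have [_ _ <- _] := mx_ofP g; exists x. Qed.

Lemma isom_bq g x y : bq (mx_of g *m x) (mx_of g *m y) = bq x y.
Proof.
have [_ gq _ _] := mx_ofP g.
move: (gq (x + y)) (gq x) (gq y); rewrite mulmxDr !bqE.
by rewrite (bqC (_ *m y)) (bqC y); lra.
Qed.

Definition nondeg_refl g a :=
  ev a (e4 R) = 2 /\ forall x, mx_of g *m x = x - ev a x *: e4 R.
Definition deg_refl g v :=
  q0 v = 1 /\ forall x, mx_of g *m x = x - (2 * bq v x) *: v.

(** The mirror expressed through [g] alone, so that it can be followed along a deformation. *)
Definition fix_HP4 g : set 'cV[R]_5 := HP4 `&` [set x | mx_of g *m x = x].

(** The two kinds come from the sign in [g e4 = ± e4]. With sign +, [a] kills [e4] and invariance of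
    [bq] makes [a] proportional to [bq v]; with sign -, [v] itself is a multiple of [e4]. *)
Lemma rank1_refl g v a : (g * g = 1)%g -> g <> 1%g ->
  (forall x, mx_of g *m x = x - ev a x *: v) ->
  (exists a', nondeg_refl g a') \/ (exists v', deg_refl g v').
Proof.
move=> gg g1 gE.
have v0 : v != 0.
  apply/eqP => v0; apply: g1; apply: eq_isom => x.
  by rewrite gE v0 scaler0 subr0 mx_of1 mul1mx.
have [y0 ay0] : exists y, ev a y = 1.
  apply: ev_neq0; apply/eqP => a0; apply: g1; apply: eq_isom => x.
  by rewrite gE a0 /ev mul0mx mxE scale0r subr0 mx_of1 mul1mx.
(* Applying [g] twice to [y0] subtracts [(2 - ev a v) *: v]. *)
have av : ev a v = 2.
  have : mx_of (g * g)%g *m y0 = y0 by rewrite gg mx_of1 mul1mx.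
  rewrite mx_ofM -mulmxA !gE !evE ay0 mul1r scale1r.
  move/eqP; rewrite -addrA -opprD subr_eq_self.
  rewrite -{1}[v]scale1r -scalerDl scaler_eq0 (negPf v0) orbF => /eqP; lra.
have [_ _ _ ge4] := mx_ofP g.
case: ge4; rewrite gE => /eqP.
  rewrite subr_eq_self scaler_eq0 (negPf v0) orbF.
  move=> /eqP ae4; right.
  (* Invariance of [bq] on [v] and [y], where [g] negates [v]. *)
  have bv y : 2 * bq v y = q0 v * ev a y.
    have := isom_bq g v y; rewrite !gE av !bqE; lra.
  (* If [q0 v = 0] then [v] lies in the radical, where [a] vanishes; if [q0 v < 0] then a multiple
     of [v] lies in [HP4] and [g] sends it to the lower sheet. *)
  have qv : 0 < q0 v.
    rewrite lt_neqAle eq_sym leNgt; apply/andP; split.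
      apply/eqP => qv; have [c vE] : exists c, v = c *: e4 R.
        by apply: bq_radical => y; move: (bv y); rewrite qv mul0r; lra.
      by move: av; rewrite vE evZ ae4 mulr0; lra.
    apply/negP => /HP4_of_timelike[c c0 hv]; have [_ vp] := hv.
    have [_] := isom_HP4 g hv; rewrite gE evZ av.
    by move: vp; rewrite !xcoordE; lra.
  pose s := Num.sqrt (q0 v).
  have s0 : s != 0 by rewrite gt_eqF // sqrtr_gt0.
  have s2 : s ^+ 2 = q0 v by rewrite sqr_sqrtr // ltW.
  exists (s^-1 *: v); split.
    by rewrite q0E bqZl bqZr -q0E -s2; field.
  move=> x; rewrite gE bqZl scalerA; congr (_ - _ *: _).
  by apply: (mulfI (expf_neq0 2 s0)); rewrite {1}s2 -bv; field.
(* Remaining case: [g] negates [e4]. Rescaling [v] to [e4] brings the value of the functional at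
   [e4] to 2. *)
rewrite subr_eq addrC -subr_eq opprK eq_sym => /eqP ve; left.
set c := ev a (e4 R) in ve.
have c0 : c != 0.
  apply/eqP => c0; move: ve; rewrite c0 scale0r => /esym/eqP.
  rewrite -{1 2}[e4 R]scale1r -scalerDl scaler_eq0 (negPf (e4_neq0 R)) orbF.
  by move=> /eqP; lra.
have vE : v = (2 / c) *: e4 R.
  apply: (scalerI c0); rewrite ve scalerA mulrCA divff // mulr1.
  by rewrite -{1 2}[e4 R]scale1r -scalerDl.
exists ((2 / c) *: a); split; first by rewrite ev_scalel -/c; field.
by move=> x; rewrite gE vE ev_scalel scalerA mulrC.
Qed.

(** For small [e > 0] the vector [x0 + e *: y] is still timelike, so a multiple of it lies in the
    mirror; linearity then gives that [y] is fixed. *)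
Lemma hyperplane_span g a x0 : HP4 x0 -> ev a x0 = 0 ->
  (forall x, HP4 x -> ev a x = 0 -> mx_of g *m x = x) ->
  forall y, ev a y = 0 -> mx_of g *m y = y.
Proof.
move=> hx0 ax0 gH y ay.
(* With [e = 1 / k <= 1], the terms beyond [q0 x0 = -1] add up to at most [e * (k - 1) = 1 - e], so
   [q0] stays negative. *)
pose k := 1 + 2 * `|bq x0 y| + `|q0 y|.
have k1 : 1 <= k.
  by rewrite /k; move: (normr_ge0 (bq x0 y)) (normr_ge0 (q0 y)); lra.
pose e := k^-1.
have k0 : 0 < k by lra.
have e0 : 0 < e by rewrite invr_gt0.
have e1 : e <= 1 by rewrite invf_le1.
have ek : e * k = 1 by rewrite mulVf // gt_eqF.
have q : q0 (x0 + e *: y) < 0.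
  have [qx0 _] := hx0.
  rewrite !bqE (bqC y) -!q0E qx0.
  have b1 := ler_norm (bq x0 y); have b2 := ler_norm (q0 y).
  have b3 : e * bq x0 y <= e * `|bq x0 y| by rewrite ler_pM2l.
  have b4 : e * (e * q0 y) <= e * `|q0 y|.
    rewrite ler_pM2l //; apply: le_trans (_ : e * `|q0 y| <= _).
      by rewrite ler_pM2l.
    by rewrite ler_piMl.
  by move: ek; rewrite /k; lra.
have [c c0 hc] := HP4_of_timelike q.
have : mx_of g *m (c *: (x0 + e *: y)) = c *: (x0 + e *: y).
  by apply: gH => //; rewrite !evE ax0 ay; ring.
rewrite -scalemxAr => /(scalerI c0); rewrite mulmxDr (gH x0) // => /addrI.
by rewrite -scalemxAr => /scalerI ->; rewrite ?gt_eqF.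
Qed.

(** By [hyperplane_span], [g - 1] vanishes on the kernel of [a]; its value at a vector where [a]
    equals 1 gives [- v]. *)
Lemma reflection_rank1 g H : reflection_in g H ->
  exists v a, [/\ v != 0, forall x, mx_of g *m x = x - ev a x *: v &
                  H = HP4 `&` [set x | ev a x = 0]].
Proof.
move=> [[[x0 Hx0] [a a0 HE]] g1 gg gH].
have {}HE : H = HP4 `&` [set x | ev a x = 0].
  by rewrite HE; congr (_ `&` _); apply/seteqP; split=> x /= /ev_eq0.
have [y1 ay1] := ev_neq0 a0.
have [hx0 ax0] : HP4 x0 /\ ev a x0 = 0 by move: Hx0; rewrite HE.
have gK : forall y, ev a y = 0 -> mx_of g *m y = y.
  by apply: (hyperplane_span hx0 ax0) => x hx ax; apply: gH; rewrite HE.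
pose v := y1 - mx_of g *m y1.
have gE x : mx_of g *m x = x - ev a x *: v.
  have := gK (x - ev a x *: y1); rewrite !evE ay1 mulr1 subrr => /(_ erefl).
  rewrite mulmxBr -scalemxAr /v scalerBr => /eqP.
  by rewrite subr_eq => /eqP ->; rewrite opprB addrA addrAC.
exists v, a; split => //.
apply/eqP => v0; apply: g1; apply: eq_isom => x.
by rewrite gE v0 scaler0 subr0 mx_of1 mul1mx.
Qed.

Lemma reflection_fix g H : reflection_in g H -> H = fix_HP4 g.
Proof.
move=> /reflection_rank1[v [a [v0 gE ->]]]; congr (_ `&` _).
apply/seteqP; split=> x /=; rewrite gE; first by move=> ->; rewrite scale0r subr0.
move/eqP; rewrite subr_eq_self scaler_eq0.
by rewrite (negPf v0) orbF => /eqP.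
Qed.

Lemma nondeg_fix g a x : nondeg_refl g a -> mx_of g *m x = x <-> ev a x = 0.
Proof.
move=> [_ gE]; rewrite gE; split=> [|->]; last by rewrite scale0r subr0.
move/eqP; rewrite subr_eq_self scaler_eq0.
by rewrite (negPf (e4_neq0 R)) orbF => /eqP.
Qed.

Lemma deg_fix g v x : deg_refl g v -> mx_of g *m x = x <-> bq v x = 0.
Proof.
move=> [qv gE]; rewrite gE; split=> [|->]; last by rewrite mulr0 scale0r subr0.
move/eqP; rewrite subr_eq_self scaler_eq0.
move=> /orP[/eqP|/eqP v0]; first lra.
by move: qv; rewrite v0 q0E bq0l; lra.
Qed.

Lemma refl_cases g H : reflection_in g H ->
  (exists a, nondeg_refl g a) \/ (exists v, deg_refl g v).
Proof.
move=> gH; have [v [a [_ gE _]]] := reflection_rank1 gH.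
by have [_ g1 gg _] := gH; apply: rank1_refl gE.
Qed.

Lemma nondeg_refl_e4 g a : nondeg_refl g a -> mx_of g *m e4 R = - e4 R.
Proof.
by move=> [ae gE]; rewrite gE ae scaler_nat mulr2n opprD addNKr.
Qed.

Lemma deg_refl_e4 g v : deg_refl g v -> mx_of g *m e4 R = e4 R.
Proof. by move=> gv; apply/(deg_fix _ gv); rewrite bq_e4r. Qed.

Lemma e4_neqN : e4 R <> - e4 R.
Proof.
move/eqP; rewrite -subr_eq0 opprK -{1 2}[e4 R]scale1r -scalerDl scaler_eq0.
by rewrite (negPf (e4_neq0 R)) orbF => /eqP; lra.
Qed.

Lemma nondeg_refl_fix g a : nondeg_refl g a -> ~ degenerate (fix_HP4 g).
Proof.
move=> ga [x hx gx]; have [ae _] := ga.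
have /(nondeg_fix _ ga) h0 := (gx 0).2; have /(nondeg_fix _ ga) h1 := (gx 1).2.
by move: h0 h1; rewrite !evE ae; lra.
Qed.

Lemma nondeg_reflP g a : nondeg_refl g a ->
  (g * g = 1)%g -> reflection_in g (fix_HP4 g).
Proof.
move=> ga gg; have [ae gE] := ga; split => //; last by move=> x [].
  split.
    (* Sliding the time vector along [e4] into the kernel of [a] changes neither [q0] nor the time
       coordinate. *)
    exists (delta_mx (inord 0) 0 - (ev a (delta_mx (inord 0) 0) / 2) *: e4 R).
    split; last by apply/(nondeg_fix _ ga); rewrite !evE ae; field.
    split; last by rewrite !xcoordE xcoord_delta // xcoord_e4 //= ; lra.
    by rewrite !bqE /bq !xcoord_delta //=; ring.
  exists a; first by apply/eqP => a0; move: ae; rewrite a0 /ev mul0mx mxE; lra.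
  congr (_ `&` _); apply/seteqP; split=> x /=.
    by move=> /(nondeg_fix _ ga)/ev_eq0.
  by move=> /ev_eq0/(nondeg_fix _ ga).
by move=> g1; have := nondeg_refl_e4 ga; rewrite g1 mx_of1 mul1mx => /e4_neqN.
Qed.

Lemma deg_refl_nonempty g v : deg_refl g v -> exists x, fix_HP4 g x.
Proof.
move=> gv; have [qv _] := gv.
pose t : 'cV[R]_5 := delta_mx (inord 0) 0.
have qt : q0 t = -1 by rewrite /q0 !xcoord_delta //=; ring.
have vx : bq v (t - bq t v *: v) = 0.
  by rewrite !bqE -(q0E v) qv (bqC v t); ring.
(* Removing the [v]-component of [t] lowers [q0] from -1 by [bq t v ^+ 2]. *)
have /HP4_of_timelike[c c0 hc] : q0 (t - bq t v *: v) < 0.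
  rewrite q0E bqDl bqNl bqZl vx bqDr bqNr bqZr -q0E qt.
  by have := sqr_ge0 (bq t v); lra.
exists (c *: (t - bq t v *: v)); split=> //.
by apply/(deg_fix _ gv); rewrite bqZr vx mulr0.
Qed.

Lemma deg_refl_fix g v : deg_refl g v -> degenerate (fix_HP4 g).
Proof.
move=> gv; have [x [hx /(deg_fix _ gv) vx]] := deg_refl_nonempty gv.
exists x => // c; split; last by apply/(deg_fix _ gv); rewrite !bqE vx; ring.
have [qx x0] := hx; split; first by rewrite !bqE -q0E qx; ring.
by rewrite !xcoordE xcoord_e4 //= mulr0 addr0.
Qed.

Lemma deg_reflP g v : deg_refl g v ->
  (g * g = 1)%g -> reflection_in g (fix_HP4 g).
Proof.
move=> gv gg; have [qv gE] := gv; split => //; last by move=> x [].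
  split; first exact: deg_refl_nonempty gv.
  exists (dual v).
    by apply/eqP => v0; have := ev_dual v v; rewrite v0 /ev mul0mx mxE -q0E qv; lra.
  congr (_ `&` _); apply/seteqP; split=> x /=.
    by move=> /(deg_fix _ gv) vx; apply/ev_eq0; rewrite ev_dual.
  by move=> /ev_eq0; rewrite ev_dual => /(deg_fix _ gv).
move=> g1; have /(deg_fix _ gv) : mx_of g *m v = v by rewrite g1 mx_of1 mul1mx.
by rewrite -q0E qv; lra.
Qed.

(** The two composites move [x] along [e4] by opposite amounts, [ev c x - ev a x] and its
    negative. *)
Lemma nondeg_comm g h a c : nondeg_refl g a -> nondeg_refl h c ->
  (g * h = h * g)%g -> g = h.
Proof.
move=> [ae gE] [ce hE] gh; apply: eq_isom => x; rewrite gE hE.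
have := congr1 (fun k => mx_of k *m x) gh; rewrite !mx_ofM -!mulmxA !(gE, hE) !evE ae ce.
by move=> /(congr1 (ev a)); rewrite !evE ae => ac; congr (_ - _ *: _); lra.
Qed.

(** At [v] the two composites differ by [2 * ev a v] times [e4]. *)
Lemma nondeg_deg_comm g h a v : nondeg_refl g a -> deg_refl h v ->
  (g * h = h * g)%g -> ev a v = 0.
Proof.
move=> [ae gE] [qv hE] gh.
have := congr1 (fun k => mx_of k *m v) gh; rewrite !mx_ofM -!mulmxA !(gE, hE) !evE.
rewrite !bqE -q0E qv => /(congr1 (fun y => ev a y)); rewrite !evE ae; lra.
Qed.

Lemma deg_refl_scale g h u k v :
  deg_refl g u -> deg_refl h v -> u = k *: v -> g = h.
Proof.
move=> [qu gE] [qv hE] uE; apply: eq_isom => x; rewrite gE hE uE bqZl scalerA.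
move: qu; rewrite uE q0E bqZl bqZr -q0E qv mulr1 => kk.
by congr (_ - _ *: _); rewrite -[RHS]mul1r -kk; ring.
Qed.

(** Comparing the composites at [v], with [b = bq u v], gives [4 b (u - b v) = 0]; if [b] is nonzero
    the normals are proportional and the reflections agree. *)
Lemma deg_comm g h u v : deg_refl g u -> deg_refl h v ->
  (g * h = h * g)%g -> g <> h -> bq u v = 0.
Proof.
move=> gu hv gh ngh; have [qu gE] := gu; have [qv hE] := hv.
apply: contrapT => /eqP uv; apply: ngh; apply: (deg_refl_scale gu hv (k := bq u v)).
have := congr1 (fun k => mx_of k *m v) gh; rewrite !mx_ofM -!mulmxA !(gE, hE) !bqE.
rewrite -q0E qv (bqC v u); set b := bq u v in uv *.
move=> /eqP; rewrite -subr_eq0 => /eqP E.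
have /eqP : (4 * b) *: (u - b *: v) = 0.
  rewrite -E scalerBr !scalerA; apply: eq_cV5; rewrite !xcoordE; ring.
rewrite scaler_eq0 mulf_eq0 (negPf uv) orbF (gt_eqF (_ : 0 < 4 :> R)) //=.
by rewrite subr_eq0 => /eqP.
Qed.

Lemma fix_eq_fixed g h H : reflection_in g H -> reflection_in h H ->
  forall x, mx_of g *m x = x -> mx_of h *m x = x.
Proof.
move=> gH hH x; have [v [a [v0 gE HE]]] := reflection_rank1 gH.
rewrite gE => /eqP; rewrite subr_eq_self scaler_eq0.
rewrite (negPf v0) orbF => /eqP ax.
have [[[x0 Hx0] _] _ _ hfix] := hH; move: Hx0; rewrite HE => -[hx0 ax0].
by apply: (hyperplane_span hx0 ax0) ax => y hy ay; apply: hfix; rewrite HE.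
Qed.

Lemma nondeg_fix_inj g h H a c : reflection_in g H -> reflection_in h H ->
  nondeg_refl g a -> nondeg_refl h c -> g = h.
Proof.
move=> gH hH ga hc; have [ae gE] := ga; have [ce hE] := hc.
apply: eq_isom => x; rewrite gE hE.
(* Each [x] is shifted along [e4] into the common fixed space; the shift computes both
   functionals. *)
have /(fix_eq_fixed gH hH)/(nondeg_fix _ hc) :
    mx_of g *m (x - (ev a x / 2) *: e4 R) = x - (ev a x / 2) *: e4 R.
  by apply/(nondeg_fix _ ga); rewrite !evE ae; field.
by rewrite !evE ce => ac; congr (_ - _ *: _); lra.
Qed.

(** A degenerate mirror sees its normal only through [bq], hence only modulo [e4], so it need not
    determine the reflection. *)
Lemma deg_fix_proj g h H u v : reflection_in g H -> reflection_in h H ->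
  deg_refl g u -> deg_refl h v -> exists k c, u - k *: v = c *: e4 R.
Proof.
move=> gH hH gu hv; have [qv _] := hv.
exists (bq u v); apply: bq_radical => y.
have /(fix_eq_fixed hH gH)/(deg_fix _ gu) :
    mx_of h *m (y - bq v y *: v) = y - bq v y *: v.
  by apply/(deg_fix _ hv); rewrite !bqE -q0E qv; ring.
by rewrite !bqE; lra.
Qed.

(** A commuting non-degenerate reflection removes the ambiguity modulo [e4]: its functional kills
    both normals but not [e4]. *)
Lemma deg_fix_inj f g h H a u v : reflection_in g H -> reflection_in h H ->
  nondeg_refl f a -> deg_refl g u -> deg_refl h v ->
  (f * g = g * f)%g -> (f * h = h * f)%g -> g = h.
Proof.
move=> gH hH fa gu hv fg fh; have [ae _] := fa.
have [k [c uv]] := deg_fix_proj gH hH gu hv.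
have au := nondeg_deg_comm fa gu fg; have av := nondeg_deg_comm fa hv fh.
apply: (deg_refl_scale gu hv (k := k)); apply/eqP; rewrite -subr_eq0 uv.
have := congr1 (ev a) uv; rewrite !evE au av ae => h0.
by rewrite (_ : c = 0) ?scale0r //; lra.
Qed.

(** A relation modulo [e4] would make [bq u] and [bq v] proportional, and the mirrors equal. *)
Lemma deg_indep g h u v : deg_refl g u -> deg_refl h v ->
  fix_HP4 g <> fix_HP4 h -> indep_e4 u v.
Proof.
move=> gu hv gh a b c E; have [qu _] := gu; have [qv _] := hv.
have P y : a * bq u y + b * bq v y = 0.
  by have := congr1 (fun t => bq t y) E; rewrite !bqE mulr0.
have a0 : a = 0.
  apply: contrapT => /eqP a0; apply: gh; congr (_ `&` _).
  have b0 : b != 0.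
    apply/eqP => b0; have /eqP := P u; rewrite b0 -q0E qu mul0r addr0 mulr1.
    by rewrite (negPf a0).
  apply/seteqP; split=> [y /= /(deg_fix _ gu)|y /= /(deg_fix _ hv)] h0.
    apply/(deg_fix _ hv); have /eqP := P y.
    by rewrite h0 mulr0 add0r mulf_eq0 (negPf b0) => /eqP.
  apply/(deg_fix _ gu); have /eqP := P y.
  by rewrite h0 mulr0 addr0 mulf_eq0 (negPf a0) => /eqP.
by split=> //; have := P v; rewrite a0 -q0E qv; lra.
Qed.

End Reflections.

(** * Points at infinity of mirrors, and open conditions on representations *)

Section Topology.
Variable R : realType.
Implicit Types (g h : GHP4 R) (a : 'rV[R]_5) (u v w x y m : 'cV[R]_5).

Lemma add_fun_continuous (T : topologicalType) (F G : T -> R) :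
  continuous F -> continuous G -> continuous (fun t => F t + G t).
Proof. by move=> cF cG t; apply: cvgD; [exact: cF|exact: cG]. Qed.

Lemma sub_fun_continuous (T : topologicalType) (F G : T -> R) :
  continuous F -> continuous G -> continuous (fun t => F t - G t).
Proof. by move=> cF cG t; apply: cvgB; [exact: cF|exact: cG]. Qed.

Lemma sum_continuous (T : topologicalType) I (r : seq I) (F : I -> T -> R) :
  (forall i, continuous (F i)) -> continuous (fun t => \sum_(i <- r) F i t).
Proof. by move=> cF; apply: continuous_big => //; exact: add_continuous. Qed.

Lemma prod_continuous (T : topologicalType) I (r : seq I) (F : I -> T -> R) :
  (forall i, continuous (F i)) -> continuous (fun t => \prod_(i <- r) F i t).
Proof. by move=> cF; apply: continuous_big => //; exact: mul_continuous. Qed.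

Lemma det_continuous (T : topologicalType) n (F : T -> 'M[R]_n) :
  (forall i j, continuous (fun t => F t i j)) -> continuous (fun t => \det (F t)).
Proof.
move=> cF; apply: sum_continuous => s t; apply: cvgM; first exact: cvg_cst.
by apply: prod_continuous => i; exact: cF.
Qed.

Lemma mulmx_entry_continuous (T : topologicalType) l n p (A : 'M[R]_(l, n))
    (F : T -> 'M[R]_(n, p)) i j :
  (forall k, continuous (fun t => F t k j)) ->
  continuous (fun t => (A *m F t) i j).
Proof.
move=> cF.
rewrite (_ : (fun _ => _) = (fun t => \sum_k A i k * F t k j)); last first.
  by apply/funext => t; rewrite mxE.
by apply: sum_continuous => k t; apply: cvgM; [exact: cvg_cst|exact: cF].
Qed.

Lemma mulmx_neq_open (A : 'M[R]_5) : open [set x : 'cV[R]_5 | A *m x <> x].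
Proof.
rewrite openE => x /= Ax; rewrite /interior.
have [i ix] : exists i, (A *m x) i 0 - x i 0 != 0.
  apply: contrapT => /forallNP ne; apply: Ax; apply/matrixP => i j; rewrite ord1.
  by apply/eqP; rewrite -subr_eq0; apply/negPn/negP/ne.
have : continuous (fun y : 'cV[R]_5 => (A *m y) i 0 - y i 0).
  have cA : continuous (fun y : 'cV[R]_5 => (A *m y) i 0).
    apply: (@mulmx_entry_continuous _ _ _ _ A (fun z : 'cV[R]_5 => z)) => k.
    exact: coord_continuous.
  by apply: sub_fun_continuous; [exact: cA|exact: coord_continuous].
move=> /(_ x)/cvgr_neq0/(_ ix); apply: filterS => y /eqP + Ay; apply.
by rewrite Ay subrr.
Qed.

(** Being fixed by [g] is closed and invariant under scaling, so it descends to projective space and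
    passes to the closure. *)
Lemma closure_fix g (v : nonzero_vec R) :
  closure [set proj_class v | v in [set v | fix_HP4 g (vec_of v)]] (proj_class v) ->
  mx_of g *m vec_of v = vec_of v.
Proof.
move=> cl; apply: contrapT => gv.
pose U : set (RP4 R) :=
  [set r | mx_of g *m vec_of (repr r) <> vec_of (repr r)].
have UE (w : nonzero_vec R) : U (proj_class w) <-> mx_of g *m vec_of w <> vec_of w.
  have : proportional w (repr (proj_class w)).
    by apply/eqmodP; rewrite reprK.
  move=> /asboolP[c c0 wE]; rewrite /U /= wE -scalemxAr.
  by split=> h e; apply: h; [rewrite e|apply: (scalerI c0)].
have oU : open U.
  rewrite /open /= /quotient_open.
  rewrite (_ : _ @^-1` U =
      (@vec_of R) @^-1` [set x : 'cV[R]_5 | mx_of g *m x <> x]).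
    by exists [set x : 'cV[R]_5 | mx_of g *m x <> x] => //; exact: mulmx_neq_open.
  by apply/seteqP; split=> w /UE.
have [_ [[w [_ gw] <-] /UE]] := cl U (open_nbhs_nbhs (conj oU ((UE v).2 gv))).
by apply.
Qed.

Lemma asymptotic_null_fix (p : RP4 R) : boundary_HP4 p ->
  exists v : nonzero_vec R, [/\ p = proj_class v, q0 (vec_of v) = 0 &
    forall g, asymptotic (fix_HP4 g) p -> mx_of g *m vec_of v = vec_of v].
Proof. by move=> [v qv <-]; exists v; split=> // h [_ /closure_fix]. Qed.

(** Converse of [closure_fix]: the null vector is a limit of fixed timelike vectors, obtained by
    adding small multiples of [x0] and normalised into the mirror. *)
Lemma asymptotic_fix g x0 (v : nonzero_vec R) :
  fix_HP4 g x0 -> mx_of g *m vec_of v = vec_of v -> q0 (vec_of v) = 0 ->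
  ~ (exists c, vec_of v = c *: e4 R) -> asymptotic (fix_HP4 g) (proj_class v).
Proof.
move=> [hx0 gx0] gv qv ve; split; first by exists v.
have [qx0 _] := hx0.
have b0 : bq x0 (vec_of v) != 0.
  apply/eqP => b0; apply: ve; apply: bq_timelike_null qv b0.
  by rewrite qx0; lra.
move=> B; rewrite nbhsE => -[U [oU Uv] UB].
have : nbhs v (@proj_class R @^-1` U) by apply: open_nbhs_nbhs; split.
rewrite nbhsE => -[V [[W oW <-] Wv] OinU].
set m := vec_of v in gv qv ve b0 *.
(* This sign makes the cross term of [q0 (m + (e * s) *: x0)] negative; the cross term is nonzero
   because [m] is not a multiple of [e4]. *)
pose s := - Num.sg (bq x0 m).
have s0 : s != 0 by rewrite oppr_eq0 sgr_eq0.
have sb : s * bq x0 m < 0.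
  by rewrite mulNr -normrEsg oppr_lt0 normr_gt0.
have : (m + (e * s) *: x0) @[e --> (0 : R)] --> m + (0 * s) *: x0.
  apply: cvgD; first exact: cvg_cst.
  by apply: cvgZr_tmp; apply: cvgMr_tmp; exact: cvg_id.
rewrite mul0r scale0r addr0 => /(_ W (open_nbhs_nbhs (conj oW Wv))).
move=> /nbhs_ballP[d /= d0 dW].
pose e := d / 2; have e0 : 0 < e by rewrite divr_gt0.
pose y := m + (e * s) *: x0.
have Wy : W y.
  by apply: dW; rewrite /ball /= sub0r normrN gtr0_norm // /e; lra.
have qy : q0 y < 0.
  rewrite /y !bqE (bqC m) -!q0E qv qx0.
  have es : e * (s * bq x0 m) < 0 by rewrite pmulr_rlt0.
  by have := sqr_ge0 (e * s); lra.
have y0 : y != 0 by apply/eqP => y0; move: qy; rewrite y0 q0E bq0l ltxx.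
have [c c0 hy] := HP4_of_timelike qy.
have cy0 : c *: y != 0 by rewrite scaler_eq0 negb_or c0.
pose y' : nonzero_vec R := exist _ y (mem_set y0).
pose cy' : nonzero_vec R := exist _ (c *: y) (mem_set cy0).
exists (proj_class cy'); split.
  exists cy' => //; split=> //=.
  by rewrite -scalemxAr mulmxDr gv -scalemxAr gx0.
apply: UB; rewrite (_ : proj_class cy' = proj_class y'); first exact: OinU.
by apply/esym/eqmodP/asboolP; exists c.
Qed.

Lemma hom_entry_continuous s i j :
  continuous (fun rho : cube_hom R => mx_of (gen_image rho s) i j).
Proof.
move=> rho.
have c1 : continuous (@gen_image R : cube_hom R -> {ptws face -> GHP4 R}).
  exact: initial_continuous.
have c2 : continuous (proj s : {ptws face -> GHP4 R} -> GHP4 R).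
  exact: proj_continuous.
have c3 : continuous (@mx_of R) by exact: initial_continuous.
have c4 := @coord_continuous R 5 5 i j.
apply: (@continuous_comp _ _ _
  (fun r : cube_hom R => mx_of (gen_image r s)) (fun M => M i j)); last exact: c4.
apply: (@continuous_comp _ _ _
  (fun r : cube_hom R => gen_image r s) (@mx_of R)); last exact: c3.
apply: (@continuous_comp _ _ _
  (@gen_image R : cube_hom R -> {ptws face -> GHP4 R}) (proj s)); last exact: c2.
exact: c1.
Qed.

(** At [rho] itself the matrix is twice the identity, and the determinant is continuous. *)
Lemma near_unit (rho : cube_hom R) s :
  (gen_image rho s * gen_image rho s = 1)%g ->
  \forall rho' \near rho,
    1%:M + mx_of (gen_image rho s) *m mx_of (gen_image rho' s) \in unitmx.
Proof.
move=> gg; set A := mx_of (gen_image rho s).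
have : continuous (fun r : cube_hom R => \det (1%:M + A *m mx_of (gen_image r s))).
  apply: det_continuous => i j.
  rewrite (_ : (fun _ => _) = (fun r : cube_hom R =>
      1%:M i j + (A *m mx_of (gen_image r s)) i j)); last first.
    by apply/funext => r; rewrite mxE.
  apply: add_fun_continuous; first exact: cst_continuous.
  by apply: mulmx_entry_continuous => k; exact: hom_entry_continuous.
move=> /(_ rho)/cvgr_neq0; rewrite -mx_ofM gg mx_of1 => h.
have : \det (1%:M + 1%:M : 'M[R]_5) != 0.
  by rewrite -mulr2n -scaler_nat detZ det1 mulr1 expf_neq0 // pnatr_eq0.
by move=> /h; apply: filterS => r; rewrite unitmxE unitfE.
Qed.

Lemma near_neq (rho : cube_hom R) s t : gen_image rho s <> gen_image rho t ->
  \forall rho' \near rho, gen_image rho' s <> gen_image rho' t.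
Proof.
move=> st.
have [i [j ij]] : exists i j,
    mx_of (gen_image rho s) i j - mx_of (gen_image rho t) i j != 0.
  apply: contrapT => /forallNP ne; apply: st; apply: mx_of_inj; apply/matrixP => i j.
  have /forallNP/(_ j) := ne i.
  by move=> /negP/negPn; rewrite subr_eq0 => /eqP.
have : continuous (fun r : cube_hom R =>
    mx_of (gen_image r s) i j - mx_of (gen_image r t) i j).
  by apply: sub_fun_continuous; exact: hom_entry_continuous.
move=> /(_ rho)/cvgr_neq0/(_ ij); apply: filterS => r /eqP + e; apply.
by rewrite e subrr.
Qed.

(* [T] intertwines the involutions [g] and [h], so [h] is conjugate to [g]. *)
Lemma conjugate_refl g h v a : (g * g = 1)%g -> (h * h = 1)%g -> g <> 1%g ->
  (forall x, mx_of g *m x = x - ev a x *: v) ->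
  1%:M + mx_of g *m mx_of h \in unitmx ->
  ((exists a', nondeg_refl h a') \/ (exists v', deg_refl h v')) /\
  (mx_of h *m e4 R = e4 R <-> mx_of g *m e4 R = e4 R).
Proof.
move=> gg hh g1 gE; set T := _ + _ => uT.
have gg1 : mx_of g *m mx_of g = 1%:M by rewrite -mx_ofM gg.
have hh1 : mx_of h *m mx_of h = 1%:M by rewrite -mx_ofM hh.
have Th : T *m mx_of h = mx_of g *m T.
  by rewrite mulmxDl mulmxDr mul1mx mulmx1 -mulmxA hh1 mulmx1 mulmxA gg1 mul1mx addrC.
have hT : mx_of h = invmx T *m mx_of g *m T by rewrite -mulmxA -Th mulKmx.
split.
  apply: (rank1_refl (v := invmx T *m v) (a := a *m T)) => //.
    move=> h1; apply: g1; apply: mx_of_inj; rewrite mx_of1.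
    have := Th; rewrite h1 mx_of1 mulmx1 => /(congr1 (mulmx^~ (invmx T))).
    by rewrite mulmxV // mulmxK.
  move=> x; rewrite hT -!mulmxA gE mulmxBr mulKmx // -scalemxAr; congr (_ - _ *: _).
  by rewrite /ev mulmxA.
(* If [g] and [h] acted on [e4] with opposite signs, the invertible [T] would kill [e4]. *)
have E4 : T *m e4 R = e4 R + mx_of g *m (mx_of h *m e4 R).
  by rewrite mulmxDl mul1mx mulmxA.
have ne : T *m e4 R <> 0.
  move=> /(congr1 (mulmx (invmx T))); rewrite mulKmx // mulmx0.
  by move/eqP; rewrite (negPf (e4_neq0 R)).
have [_ _ _ he] := mx_ofP h; have [_ _ _ ge] := mx_ofP g.
case: he ge => hE [] gE4.
- by split.
- by exfalso; apply: ne; rewrite E4 hE gE4 subrr.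
- by exfalso; apply: ne; rewrite E4 hE mulmxN gE4 subrr.
- by split; rewrite ?hE ?gE4 => /esym/e4_neqN.
Qed.

End Topology.

(** * Combinatorics of the six faces *)

Lemma third_axis (i j : 'I_3) : exists k : 'I_3, k != i /\ k != j.
Proof.
have /existsP[k] : [exists k, k \notin [:: i; j]].
  rewrite -negb_forall; apply/negP => /forallP ij.
  have := card_size [:: i; j].
  by rewrite (eq_card (B := 'I_3)) ?card_ord // => k; rewrite ij.
by rewrite !inE negb_or => /andP; exists k.
Qed.

Lemma other_axes (i : 'I_3) : exists j k : 'I_3,
  [/\ j <> i, k <> i, k <> j & forall l, [\/ l = i, l = j | l = k]].
Proof.
have [j [ji _]] := third_axis i i; have [k [ki kj]] := third_axis i j.
exists j, k; split; [exact/eqP..|] => l.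
have [->|li] := eqVneq l i; first by constructor 1.
have [->|lj] := eqVneq l j; first by constructor 2.
have [->|lk] := eqVneq l k; first by constructor 3.
have : uniq [:: l; k; j; i] by rewrite /= !inE !negb_or li lj lk ki kj ji.
move=> /card_uniqP /= sz; have := max_card [in [:: l; k; j; i]].
by rewrite sz card_ord.
Qed.

Definition opp_face (s : face) : face := (s.1, ~~ s.2).

Lemma opp_face_neq s : opp_face s <> s.
Proof. by case: s => i []. Qed.

Lemma same_axis (s t : face) : s.1 = t.1 -> t = s \/ t = opp_face s.
Proof. by case: s t => i [] [j []] /= ->; [left|right|right|left]. Qed.

(** Choosing one face per value lists five of the six faces; the face [t] left out repeats the value
    of one of them. *)
Lemma card_range5 (X : pointedType) (H : face -> X) : (range H #= `I_5)%card ->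
  exists t t', [/\ t <> t', H t = H t' &
    forall s s', s <> t -> s' <> t -> H s = H s' -> s = s'].
Proof.
rewrite card_eq_sym => /card_set_bijP[f [fsub finj fsurj]].
have /choice[c cE] : forall i : 'I_5, exists s, H s = f i.
  by move=> i; have [s _ sE] := fsub i (ltn_ord i); exists s.
have cinj : injective c.
  move=> i j ij; apply/val_inj/finj; rewrite ?inE //= ?ltn_ord //.
  by rewrite -!cE ij.
have card_c : #|codom c| = 5%N by rewrite card_codom // card_ord.
have [t tc] : exists t, t \notin codom c.
  apply/existsP; rewrite -negb_forall; apply/negP => /forallP all_c.
  have : #|codom c| = #|face| by apply: eq_card => s; rewrite all_c.
  by rewrite card_c card_prod card_ord card_bool.
have cP s : s <> t -> exists i, s = c i.
  move=> st; apply: contrapT => ns.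
  have sc : s \notin codom c by apply/negP => /codomP.
  have : uniq (s :: t :: codom c).
    rewrite /= inE negb_or sc tc (map_inj_uniq cinj) enum_uniq.
    by move/eqP: st => ->.
  move=> /card_uniqP /= sz; have := max_card [in s :: t :: codom c].
  by rewrite sz size_codom card_prod !card_ord card_bool.
have [k k5 kE] : exists2 k, (k < 5)%N & f k = H t.
  by have [k k5 kE] := fsurj (H t) (ex_intro2 _ _ t I erefl); exists k.
exists t, (c (Ordinal k5)); split.
- by move=> tE; rewrite tE codom_f in tc.
- by rewrite cE -kE.
- move=> s s' /cP[i ->] /cP[j ->]; rewrite !cE => ij; congr c.
  by apply/val_inj/finj; rewrite ?inE //= ?ltn_ord.
Qed.

(** * The pattern of mirrors in cusp groups and collapsed cusp groups *)

Section Cusps.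
Variable R : realType.
Implicit Types (rho : cube_hom R) (s t r : face) (i : 'I_3).

Lemma gen_sq rho s : (gen_image rho s * gen_image rho s = 1)%g.
Proof.
have r1 : rho 1%g = 1%g.
  by apply: (mulgI (rho 1%g)); rewrite -gmulfM !mulg1.
rewrite /gen_image -gmulfM -r1; congr (rho _).
by rewrite [LHS]cube_mulE; apply/word_classP; exact: (same_invol [::] s [::]).
Qed.

Lemma gen_comm rho s t : adjacent_faces s t ->
  (gen_image rho s * gen_image rho t = gen_image rho t * gen_image rho s)%g.
Proof.
move=> st; rewrite /gen_image -!gmulfM; congr (rho _).
rewrite [LHS]cube_mulE [RHS]cube_mulE; apply/word_classP.
exact: (same_comm [::] [::] st).
Qed.

(** The pattern common to both kinds of group: the two reflections on the axis [i] may or may not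
    coincide, and no common ideal point is required. *)
Definition cusp_type rho i : Prop :=
  [/\ forall b, exists a, nondeg_refl (gen_image rho (i, b)) a,
      forall s, s.1 <> i -> exists v, deg_refl (gen_image rho s) v &
      forall s t, s.1 <> i -> t.1 <> i -> s <> t ->
        gen_image rho s <> gen_image rho t].

Section Structure.
Variables (rho : cube_hom R) (H : face -> set 'cV[R]_5).
Hypothesis HR : forall s, reflection_in (gen_image rho s) (H s).

Local Notation nondeg s := (exists a, nondeg_refl (gen_image rho s) a).
Local Notation deg s := (exists v, deg_refl (gen_image rho s) v).

Let HE s : H s = fix_HP4 (gen_image rho s).
Proof. exact: reflection_fix (HR s). Qed.

Lemma not_nondeg s : ~ nondeg s -> deg s.
Proof. by case: (refl_cases (HR s)). Qed.

Lemma nondeg_degenerate s : nondeg s <-> ~ degenerate (H s).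
Proof.
rewrite HE; split=> [[a]|]; first exact: nondeg_refl_fix.
by case: (refl_cases (HR s)) => // -[v /deg_refl_fix].
Qed.

Lemma adjacent_nondeg s t : s.1 <> t.1 -> nondeg s -> nondeg t -> H s = H t.
Proof.
move=> /eqP st [a sa] [c tc]; rewrite !HE.
by rewrite (nondeg_comm sa tc (gen_comm rho st)).
Qed.

Lemma adjacent_deg s t u v : s.1 <> t.1 -> H s <> H t ->
  deg_refl (gen_image rho s) u -> deg_refl (gen_image rho t) v -> bq u v = 0.
Proof.
move=> /eqP st Hst su tv; apply: (deg_comm su tv (gen_comm rho st)) => e.
by apply: Hst; rewrite !HE e.
Qed.

(** Three mutually adjacent faces would give three orthonormal normals, all orthogonal to the null
    vector [m], which [orthonormal3_null] forbids. *)
Lemma three_deg m s t r : ~ (exists c, m = c *: e4 R) -> q0 m = 0 ->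
  (forall s, mx_of (gen_image rho s) *m m = m) ->
  deg s -> deg t -> deg r -> s.1 <> t.1 -> s.1 <> r.1 -> t.1 <> r.1 ->
  H s <> H t -> H s <> H r -> H t <> H r -> False.
Proof.
move=> me qm fixm [u su] [y ty] [x rx] st sr tr Hst Hsr Htr; apply: me.
have [qu _] := su; have [qy _] := ty; have [qx _] := rx.
apply: (orthonormal3_null qu qy qx) qm _ _ _.
- exact: adjacent_deg su ty.
- exact: adjacent_deg su rx.
- exact: adjacent_deg ty rx.
- by rewrite bqC; apply/(deg_fix _ su).
- by rewrite bqC; apply/(deg_fix _ ty).
- by rewrite bqC; apply/(deg_fix _ rx).
Qed.

Lemma injective_nondeg : injective H -> exists s, nondeg s.
Proof.
move=> Hinj; apply: contrapT => /forallNP none.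
have D s := not_nondeg (none s).
pose i0 : 'I_3 := ord0; pose i1 : 'I_3 := inord 1; pose i2 : 'I_3 := ord_max.
have n01 : i0 <> i1 by move/(congr1 val); rewrite /= inordK.
have n02 : i0 <> i2 by move/(congr1 val).
have n12 : i1 <> i2 by move/(congr1 val); rewrite /= inordK.
have [u hu] := D (i0, true); have [w hw] := D (i0, false).
have [y hy] := D (i1, true); have [z hz] := D (i1, false).
have [x hx] := D (i2, true).
have orth s t a b : s.1 <> t.1 -> deg_refl (gen_image rho s) a ->
    deg_refl (gen_image rho t) b -> bq a b = 0.
  by move=> st; apply: adjacent_deg => // /Hinj e; apply: st; rewrite e.
have iuw : indep_e4 u w by apply: (deg_indep hu hw); rewrite -!HE => /Hinj.
have iyz : indep_e4 y z by apply: (deg_indep hy hz); rewrite -!HE => /Hinj.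
have uy := orth _ _ _ _ (n01 : (i0, true).1 <> (i1, true).1) hu hy.
have uz := orth _ _ _ _ (n01 : (i0, true).1 <> (i1, false).1) hu hz.
have wy := orth _ _ _ _ (n01 : (i0, false).1 <> (i1, true).1) hw hy.
have wz := orth _ _ _ _ (n01 : (i0, false).1 <> (i1, false).1) hw hz.
have ux := orth _ _ _ _ (n02 : (i0, true).1 <> (i2, true).1) hu hx.
have wx := orth _ _ _ _ (n02 : (i0, false).1 <> (i2, true).1) hw hx.
have yx := orth _ _ _ _ (n12 : (i1, true).1 <> (i2, true).1) hy hx.
have zx := orth _ _ _ _ (n12 : (i1, false).1 <> (i2, true).1) hz hx.
have [qu _] := hu; have [qy _] := hy; have [qx _] := hx.
(* [x] is orthogonal to both planes. If they span together with [e4], then [q0 x = 0]; otherwise the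
   common null vector is orthogonal to [u], [y] and [x]. *)
case: (span_or_null iuw iyz uy uz wy wz) => [sp|[a [b [me qm [mu _] [my _]]]]].
  have [a [b [c [d [e xE]]]]] := sp x.
  have := qx; rewrite q0E {1}xE !bqE ux wx yx zx; lra.
apply: me; apply: (orthonormal3_null qu qy qx) => //.
by rewrite !bqE ux wx; ring.
Qed.

(** A non-degenerate reflection negates [e4], so the common fixed vector is not a multiple of
    [e4]. *)
Lemma common_point (p : RP4 R) : (exists s, nondeg s) ->
  (forall s, asymptotic (H s) p) ->
  exists m, [/\ ~ (exists c, m = c *: e4 R), q0 m = 0 &
                forall s, mx_of (gen_image rho s) *m m = m].
Proof.
move=> [n [a na]] Hp; have [bp _] := Hp n.
have [v [_ qv vfix]] := asymptotic_null_fix bp.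
have fixv s : mx_of (gen_image rho s) *m vec_of v = vec_of v.
  by apply: vfix; rewrite -HE.
exists (vec_of v); split=> // -[c ve].
have /(nondeg_fix _ na) := fixv n; have [ae _] := na.
rewrite ve evZ ae => c0.
have /negP := set_valP v; apply; apply/eqP; rewrite [LHS]ve.
by rewrite (_ : c = 0) ?scale0r //; lra.
Qed.

(** Adjacent non-degenerate mirrors coincide, so all of them lie on one axis. Were the face opposite
    to [n] degenerate, it would complete three mutually adjacent degenerate faces. *)
Lemma injective_cusp_type (p : RP4 R) : injective H ->
  (forall s, asymptotic (H s) p) ->
  exists i, cusp_type rho i.
Proof.
move=> Hinj Hp; have [n nn] := injective_nondeg Hinj.
have [m [me qm fixm]] := common_point (ex_intro _ n nn) Hp.
have D s : s.1 <> n.1 -> deg s.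
  move=> sn; apply: not_nondeg => ns; apply: (sn).
  by rewrite (Hinj _ _ (adjacent_nondeg sn ns nn)).
have genN s t : s <> t -> gen_image rho s <> gen_image rho t.
  by move=> st e; apply: st; apply: Hinj; rewrite !HE e.
have on : nondeg (opp_face n).
  apply: contrapT => /not_nondeg on.
  have [j [/eqP ji _]] := third_axis n.1 n.1.
  have [k [/eqP ki /eqP kj]] := third_axis n.1 j.
  have HN s t : s.1 <> t.1 -> H s <> H t by move=> st /Hinj e; apply: st; rewrite e.
  by apply: (three_deg (s := opp_face n) (t := (j, true)) (r := (k, true)) me qm fixm);
    rewrite ?on //; try (by apply: D); try (by apply: HN => /= /esym); move=> /= /esym.
exists n.1; split=> // [b|s t _ _]; last exact: genN.
by have [->|->] := same_axis (erefl : n.1 = (n.1, b).1).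
Qed.

(** With [t] the repeated face and [n] a non-degenerate face other than [t], the other four faces
    are degenerate with distinct mirrors. It remains to see that [t] is opposite to [n] and repeats
    its mirror. *)
Lemma range5_cusp_type (p : RP4 R) : (range H #= `I_5)%card ->
  (range H `&` [set h | ~ degenerate h] #= `I_1)%card ->
  (forall s, asymptotic (H s) p) ->
  exists i, cusp_type rho i.
Proof.
move=> /card_range5[t [t' [tt' Ht Hinj]]] card1 Hp.
have [h hE] : exists h, range H `&` [set h | ~ degenerate h] = [set h].
  have [h Ah] := eq_cardSP _ _ card1; rewrite II0 card_eq0 => /eqP.
  rewrite setD_eq0 => Asub.
  by exists h; apply/seteqP; split=> [//|_ ->].
have [n0 nn0] : exists s, nondeg s.
  have [[n _ nE] hdeg] : (range H `&` [set h | ~ degenerate h]) h by rewrite hE.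
  by exists n; apply/nondeg_degenerate; rewrite nE.
have [m [me qm fixm]] := common_point (ex_intro _ n0 nn0) Hp.
have nondeg_eq s : nondeg s -> H s = h.
  move=> /nondeg_degenerate sN.
  by have : (range H `&` [set h | ~ degenerate h]) (H s) by []; rewrite hE.
have [n nn nt] : exists2 n, nondeg n & n <> t.
  have [n0t|] := pselect (n0 = t); last by exists n0.
  exists t'; last by move=> e; apply: tt'.
  by apply/nondeg_degenerate; rewrite -Ht -n0t; apply/nondeg_degenerate.
have D s : s <> n -> s <> t -> deg s.
  move=> sn st; apply: not_nondeg => ns; apply: sn.
  by apply: Hinj; rewrite ?(nondeg_eq s) ?(nondeg_eq n).
have tri s1 s2 s3 : s1 <> t -> s2 <> t -> s3 <> t -> deg s1 -> deg s2 -> deg s3 ->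
    s1.1 <> s2.1 -> s1.1 <> s3.1 -> s2.1 <> s3.1 -> False.
  move=> n1 n2 n3 d1 d2 d3 a12 a13 a23.
  by apply: (three_deg me qm fixm d1 d2 d3) => //; move/Hinj => e;
    [apply: a12|apply: a13|apply: a23]; rewrite e.
have ax (s s' : face) : s.1 <> s'.1 -> s <> s' by move=> ss' e; apply: ss'; rewrite e.
(* Otherwise the opposites of [n] and [t] and a face on the third axis are mutually adjacent and
   degenerate. *)
have ntE : t = opp_face n.
  have [e|nt1] := pselect (n.1 = t.1); first by case: (same_axis e) => // tn; case: nt.
  exfalso; have [k [/eqP kn /eqP kt]] := third_axis n.1 t.1.
  have o1 : opp_face n <> t by apply: ax.
  have o2 : opp_face t <> n by apply: ax => /= /esym.
  have k1 : (k, true) <> t by apply: ax.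
  have k2 : (k, true) <> n by apply: ax.
  apply: (tri (opp_face n) (opp_face t) (k, true)) => //; try (exact: opp_face_neq);
    try (by apply: D => //; exact: opp_face_neq); by move=> /= /esym.
(* Otherwise [t] inherits a degenerate mirror from [t']. The opposite of [t'] is used next to [t],
   since [t'] itself has the same mirror as [t]. *)
have t'n : t' = n.
  apply: contrapT => t'n; have t't : t' <> t by move=> e; apply: tt'.
  have a1 : t'.1 <> n.1.
    by move/esym/same_axis => [//|e]; apply: t't; rewrite e ntE.
  have [v hv] := D _ t'n t't.
  have dt : deg t.
    apply: not_nondeg => /nondeg_degenerate; apply; rewrite Ht HE.
    exact: deg_refl_fix hv.
  have [k [/eqP kn /eqP kt]] := third_axis n.1 t'.1.
  have tax : t.1 = n.1 by rewrite ntE.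
  have o1 : opp_face t' <> t by apply: ax; rewrite tax.
  have o2 : opp_face t' <> n by apply: ax.
  have k1 : (k, true) <> t by apply: ax; rewrite tax.
  have k2 : (k, true) <> n by apply: ax.
  apply: (three_deg me qm fixm dt (D _ o2 o1) (D _ k2 k1)); rewrite ?tax //=.
  - exact/nesym.
  - exact/nesym.
  - exact/nesym.
  - by rewrite Ht => /(Hinj _ _ t't o1)/esym/opp_face_neq.
  - by rewrite Ht => /(Hinj _ _ t't k1) e; apply: kt; rewrite e.
  - by move=> /(Hinj _ _ o1 k1)/(congr1 fst) /= /esym.
have nt_eq : gen_image rho n = gen_image rho t.
  have [a na] := nn.
  have [c tc] : nondeg t.
    by apply/nondeg_degenerate; rewrite Ht t'n; apply/nondeg_degenerate.
  have HRt := HR t; rewrite Ht t'n in HRt.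
  exact: nondeg_fix_inj (HR n) HRt na tc.
have genE b : gen_image rho (n.1, b) = gen_image rho n.
  have [->//|->] := same_axis (erefl : n.1 = (n.1, b).1).
  by rewrite -ntE nt_eq.
have ntax s : s.1 <> n.1 -> s <> n /\ s <> t.
  by move=> sn; split; apply: ax => //; rewrite ntE.
exists n.1; split=> [b|s /ntax[s1 s2]|s s' /ntax[_ s1] /ntax[_ s2] ss' e].
- by rewrite genE.
- exact: D.
- by apply: ss'; apply: Hinj => //; rewrite !HE e.
Qed.

End Structure.

End Cusps.

(** * Persistence of the pattern and recovery of the cusp *)

Section Deformation.
Variable R : realType.
Implicit Types (rho : cube_hom R) (s t : face) (i : 'I_3).

(** Conjugacy makes [h] a reflection of one of the two kinds, and the sign on [e4] tells which. *)
Lemma nondeg_close (g h : GHP4 R) a : (g * g = 1)%g -> (h * h = 1)%g ->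
  1%:M + mx_of g *m mx_of h \in unitmx -> nondeg_refl g a ->
  exists c, nondeg_refl h c.
Proof.
move=> gg hh u ga; have [_ gE] := ga.
have g1 : g <> 1%g.
  by have [] := nondeg_reflP ga gg.
have [[//|[v /deg_refl_e4 hv]] he] := conjugate_refl gg hh g1 gE u.
by move: (he.1 hv); rewrite (nondeg_refl_e4 ga) => /esym/e4_neqN.
Qed.

Lemma deg_close (g h : GHP4 R) v : (g * g = 1)%g -> (h * h = 1)%g ->
  1%:M + mx_of g *m mx_of h \in unitmx -> deg_refl g v ->
  exists w, deg_refl h w.
Proof.
move=> gg hh u gv; have [_ gE] := gv.
have g1 : g <> 1%g by have [] := deg_reflP gv gg.
have gE' x : mx_of g *m x = x - ev (2 *: dual v) x *: v.
  by rewrite gE ev_scalel ev_dual.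
have [[[a /nondeg_refl_e4 ha]|//] he] := conjugate_refl gg hh g1 gE' u.
by move: (he.2 (deg_refl_e4 gv)); rewrite ha => /esym/e4_neqN.
Qed.

Lemma near_cusp_type rho i : cusp_type rho i ->
  \forall rho' \near rho, cusp_type rho' i.
Proof.
move=> [hN hD hneq].
have hu : \forall rho' \near rho, forall s,
    1%:M + mx_of (gen_image rho s) *m mx_of (gen_image rho' s) \in unitmx.
  by apply: (filter_forall (F := nbhs rho)) => s; apply: near_unit; exact: gen_sq.
have hn : \forall rho' \near rho, forall s t,
    gen_image rho s <> gen_image rho t -> gen_image rho' s <> gen_image rho' t.
  apply: (filter_forall (F := nbhs rho)) => s.
  apply: (filter_forall (F := nbhs rho)) => t.
  have [st|st] := pselect (gen_image rho s = gen_image rho t).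
    by apply: nearW => r /(_ st).
  by apply: filterS (near_neq st).
apply: filterS2 hu hn => rho' u n; split.
- by move=> b; have [a /(nondeg_close (gen_sq _ _) (gen_sq _ _) (u _))] := hN b.
- by move=> s /hD[v /(deg_close (gen_sq _ _) (gen_sq _ _) (u _))].
- by move=> s t si ti st; apply/n/hneq.
Qed.

(** The common ideal point is not assumed but constructed, from the normals on the two axes other
    than [i]. *)
Lemma cusp_of_type rho i : cusp_type rho i ->
  gen_image rho (i, true) <> gen_image rho (i, false) -> cusp_group rho.
Proof.
move=> [hN hD hneq] ne.
have cases s : (exists b, s = (i, b)) \/ s.1 <> i.
  have [|] := pselect (s.1 = i); last by right.
  by case: s => j b /= ->; left; exists b.
have HR s : reflection_in (gen_image rho s) (fix_HP4 (gen_image rho s)).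
  case: (cases s) => [[b ->]|/hD[v sv]]; last exact: deg_reflP sv (gen_sq _ _).
  by have [a ha] := hN b; exact: nondeg_reflP ha (gen_sq _ _).
have [a ha] := hN true; have [c hc] := hN false.
(* Distinct reflections must be upgraded to distinct mirrors: the two kinds have different mirrors,
   and within a kind [nondeg_fix_inj] or [deg_fix_inj] applies. *)
have Hinj : injective (fun s => fix_HP4 (gen_image rho s)).
  move=> s t st; have HRt := HR t; rewrite -st in HRt.
  case: (cases s) (cases t) => [[b sE]|si] [[b' tE]|ti].
  - have [d hd] := hN b; have [e he] := hN b'.
    have := nondeg_fix_inj (HR s) HRt; rewrite sE tE => /(_ _ _ hd he) {d hd e he}.
    case: b b' {sE tE} => [] [] //= e; exfalso; exact: ne.
  - have [d hd] := hN b; have [v hv] := hD _ ti.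
    exfalso; apply: (nondeg_refl_fix hd).
    by have := deg_refl_fix hv; rewrite -sE st.
  - have [d hd] := hN b'; have [v hv] := hD _ si.
    exfalso; apply: (nondeg_refl_fix hd).
    by have := deg_refl_fix hv; rewrite -tE -st.
  - have [u hu] := hD _ si; have [v hv] := hD _ ti.
    apply: contrapT => sneqt; apply: (hneq s t) => //.
    apply: (deg_fix_inj (HR s) HRt ha hu hv); apply: gen_comm;
      by apply/eqP => /= /esym.
have [j [k [ji ki kj ijk]]] := other_axes i.
have [u hu] := hD (j, true) ji; have [w hw] := hD (j, false) ji.
have [y hy] := hD (k, true) ki; have [z hz] := hD (k, false) ki.
have orth b b' v v' : deg_refl (gen_image rho (j, b)) v ->
    deg_refl (gen_image rho (k, b')) v' -> bq v v' = 0.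
  move=> hv hv'; apply: (deg_comm hv hv'); first by apply: gen_comm; apply/eqP/nesym.
  by apply: hneq => // -[/esym].
have iuw : indep_e4 u w by apply: (deg_indep hu hw) => /Hinj.
have iyz : indep_e4 y z by apply: (deg_indep hy hz) => /Hinj.
have vanish b d l b' v : nondeg_refl (gen_image rho (i, b)) d ->
    l <> i -> deg_refl (gen_image rho (l, b')) v -> ev d v = 0.
  move=> hd li hv; apply: (nondeg_deg_comm hd hv); apply: gen_comm.
  exact/eqP/nesym.
have [sp|[al [be [me qm [mu mw] [my mz]]]]] := span_or_null iuw iyz
    (orth _ _ _ _ hu hy) (orth _ _ _ _ hu hz) (orth _ _ _ _ hw hy) (orth _ _ _ _ hw hz).
  (* Spanning case: both functionals vanish on [u], [w], [y], [z] and equal 2 at [e4], so the two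
     reflections on the axis [i] agree. *)
  exfalso; apply: ne; apply: eq_isom => x; have [ae aE] := ha; have [ce cE] := hc.
  rewrite aE cE; congr (_ - _ *: _); have [x1 [x2 [x3 [x4 [x5 ->]]]]] := sp x.
  rewrite !evE ae ce !(vanish _ _ _ _ _ ha ji hu, vanish _ _ _ _ _ ha ji hw,
    vanish _ _ _ _ _ ha ki hy, vanish _ _ _ _ _ ha ki hz).
  by rewrite !(vanish _ _ _ _ _ hc ji hu, vanish _ _ _ _ _ hc ji hw,
    vanish _ _ _ _ _ hc ki hy, vanish _ _ _ _ _ hc ki hz).
set m := _ + _ in me qm mu mw my mz.
have m0 : m != 0 by apply/eqP => m0; apply: me; exists 0; rewrite scale0r.
pose v : nonzero_vec R := exist _ m (mem_set m0).
exists (fun s => fix_HP4 (gen_image rho s)), (proj_class v); split => // s.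
have [[[x0 x0P] _] _ _ _] := HR s.
apply: (asymptotic_fix x0P) => //; rewrite -[vec_of v]/m.
have [si|sj|sk] := ijk s.1; rewrite (surjective_pairing s) ?si ?sj ?sk.
- have [d hd] := hN s.2; apply/(nondeg_fix _ hd).
  by rewrite !evE (vanish _ _ _ _ _ hd ji hu) (vanish _ _ _ _ _ hd ji hw); ring.
- by case: s.2; [apply/(deg_fix _ hu)|apply/(deg_fix _ hw)]; rewrite bqC.
- by case: s.2; [apply/(deg_fix _ hy)|apply/(deg_fix _ hz)]; rewrite bqC.
Qed.

Lemma cusp_group_inj rho s t : cusp_group rho ->
  gen_image rho s = gen_image rho t -> s = t.
Proof.
move=> [H [p [Hinj HR _]]] st; apply: Hinj.
by rewrite (reflection_fix (HR s)) (reflection_fix (HR t)) st.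
Qed.

End Deformation.

Theorem proposition5p13 (R : realType) (rho : cube_hom R)
    (hrho : cusp_group rho \/ collapsed_cusp_group rho) :
  \forall rho' \near rho,
    let collapse :=
      exists s1 s2 : face,
        [/\ s1 <> s2,
            gen_image rho s1 = gen_image rho s2,
            nondegenerate_reflection (gen_image rho s1) &
            gen_image rho' s1 = gen_image rho' s2] in
    (collapse \/ cusp_group rho') /\ ~ (collapse /\ cusp_group rho').
Proof.
have [i ti] : exists i, cusp_type rho i.
  case: hrho => [[H [p [Hinj HR Hp]]]|[H [p [c5 _ c1 HR Hp]]]].
    by have [i ti] := injective_cusp_type HR Hinj Hp; exists i.
  by have [i ti] := range5_cusp_type HR c5 c1 Hp; exists i.
have near_ne : \forall rho' \near rho,
    gen_image rho (i, true) <> gen_image rho (i, false) ->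
    gen_image rho' (i, true) <> gen_image rho' (i, false).
  have [e|ne] := pselect (gen_image rho (i, true) = gen_image rho (i, false)).
    by apply: (nearW (F := nbhs rho)) => r /(_ e).
  by apply: filterS (near_neq ne).
apply: filterS2 (near_cusp_type ti) near_ne => rho' ti' ne'; split; last first.
  (* Generators of a cusp group are pairwise distinct, so the alternatives exclude each other. *)
  by move=> [[s1 [s2 [s12 _ _ e']]] /cusp_group_inj/(_ e')].
have [e'|] := pselect (gen_image rho' (i, true) = gen_image rho' (i, false));
  last by right; exact: cusp_of_type ti' _.
left; exists (i, true), (i, false).
(* Distinctness persists near [rho], so a coincidence for [rho'] comes from one already present for
   [rho]. *)
have e : gen_image rho (i, true) = gen_image rho (i, false).
  by apply: contrapT => /ne'.
split=> //; have [hN _ _] := ti; have [a ha] := hN true.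
exists (fix_HP4 (gen_image rho (i, true))); first exact: nondeg_refl_fix ha.
exact: nondeg_reflP ha (gen_sq _ _).
Qed.
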